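(* Let $\mathcal{X}$ be a finite set, $U:\mathcal{X}\to\mathbb{R}$ with $\min_xU(x)=0$, and $Q$ the generator of an ergodic continuous-time Markov chain on $\mathcal{X}$ reversible with respect to its stationary distribution $\pi$. Suppose $c_{M_2}>0$. Let $\epsilon>0$, let $$T(t)=\frac{c_{M_2}+\epsilon}{\log(t+1)},$$ and let $X^{M_2}$ be the non-homogeneous continuous-time Markov chain with generators $(M_{2,t})_{t\ge0}$ and transition semigroup $(P^{M_2}_{s,t})_{0\le s\le t}$. Then: (1) $X^{M_2}$ is strongly ergodic and converges to $\pi_{min}$ in total variation distance: for all $s\geq 0$, $$\lim_{t\to\infty}\sup_{x\in\mathcal{X}}\|P^{M_2}_{s,t}(x,\cdot)-\pi_{min}\|_{TV}=0.$$ (2) $X^{M_2}$ converges in relative entropy: for every $x\in\mathcal{X}$, $$\lim_{t\to\infty}\mathrm{Ent}_{\pi_{T(t)}}\big(P^{M_2}_{0,t}(x,\cdot)\big)=0.$$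
   Context: $\mathcal{X}$ has at least two points. Reversibility: $\pi(x)Q(x,y)=\pi(y)Q(y,x)$ for all $x,y$. For $x\neq y$, $M_{2,t}(x,y)=Q(x,y)\max\{1,e^{(U(x)-U(y))/T(t)}\}=Q(x,y)e^{(U(x)-U(y))_+/T(t)}$ (with $a_+=\max\{a,0\}$), and $M_{2,t}(x,x)=-\sum_{z\neq x}M_{2,t}(x,z)$. $P^{M_2}_{s,t}(x,y)$ is the probability that the chain with these time-dependent generators, started at $x$ at time $s$, is at $y$ at time $t$ (so $\partial_tP_{s,t}=P_{s,t}M_{2,t}$, $P_{s,s}=I$). The Gibbs distribution is $\pi_{T(t)}(x)=e^{-U(x)/T(t)}\pi(x)/Z_{T(t)}$, with $Z_{T(t)}=\sum_xe^{-U(x)/T(t)}\pi(x)$. At $t=0$, $1/T(0)$ is read as $0$. $U_{min}=\{x: U(x)=\min_yU(y)\}$; $\pi_{min}(x)=\pi(x)/\pi(U_{min})$ for $x\in U_{min}$ and $\pi_{min}(x)=0$ otherwise. $\|\mu-\nu\|_{TV}=\frac12\sum_x|\mu(x)-\nu(x)|$. $\mathrm{Ent}_\nu(\mu)=\sum_x\mu(x)\log(\mu(x)/\nu(x))$. A path from $x$ to $y$ is a sequence $\gamma=(\gamma_i)_{i=0}^n$ with $\gamma_0=x$, $\gamma_n=y$ and $Q(\gamma_{i-1},\gamma_i)>0$ for $i=1,\ldots,n$; $\Gamma^{x,y}$ is the set of such paths. $\mathrm{Elev}_2(\gamma)=\max_{1\le i\le n}\min\{U(\gamma_{i-1}),U(\gamma_i)\}$,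 $H_2(x,y)=\min_{\gamma\in\Gamma^{x,y}}\mathrm{Elev}_2(\gamma)$, and $c_{M_2}=\max_{x\neq y}\{H_2(x,y)-U(x)-U(y)\}$. *)

(* Defs.v *)
From HB Require Import structures.
From mathcomp Require Import all_boot all_order all_algebra.
From mathcomp Require Import all_classical all_reals all_analysis.

Set Implicit Arguments.
Unset Strict Implicit.
Unset Printing Implicit Defensive.

Import Order.TTheory GRing.Theory Num.Theory.
Import numFieldNormedType.Exports.

Local Open Scope classical_set_scope.
Local Open Scope ring_scope.

Section Defs.
Context {R : realType} {X : finType}.
Implicit Types (U pi mu nu : X -> R) (Q : X -> X -> R) (x y : X) (T : R).

Definition is_distribution mu : Prop :=
  (forall x, 0 <= mu x) /\ \sum_x mu x = 1.

Definition is_generator Q : Prop :=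
  (forall x y, x != y -> 0 <= Q x y) /\ (forall x, \sum_y Q x y = 0).

(* The path (x, p_1, ..., p_n) is represented by its starting point x and the
   sequence p of its other vertices. *)
Definition is_path Q x y (p : seq X) : Prop :=
  path (fun a b => 0 < Q a b) x p /\ last x p = y.

(* A continuous-time chain on a finite set has no periodicity, so ergodicity
   (all states positive recurrent, in a single class) is irreducibility. *)
Definition ergodic Q : Prop := forall x y, exists p, is_path Q x y p.

Definition stationary Q pi : Prop :=
  is_distribution pi /\ forall y, \sum_x pi x * Q x y = 0.

Definition reversible Q pi : Prop :=
  forall x y, pi x * Q x y = pi y * Q y x.

(* The maximum of a nonempty sequence; 0 on the empty sequence. *)
Definition seqmax (s : seq R) : R := \big[Num.max/head 0 s]_(a <- s) a.

Definition Elev2 U x (p : seq X) : R :=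
  seqmax (pairmap (fun a b => Num.min (U a) (U b)) x p).

(* For x != y and Q ergodic the set is nonempty, and it is finite since its
   elements are values of U, so that this infimum is a minimum. *)
Definition H2 U Q x y : R :=
  inf [set Elev2 U x p | p in [set p | is_path Q x y p]].

Definition c_M2 U Q : R :=
  seqmax [seq H2 U Q xy.1 xy.2 - U xy.1 - U xy.2
         | xy <- enum [pred xy : X * X | xy.1 != xy.2]].

(* In mathcomp 0^-1 = 0 and ln 1 = 0, hence temperature U Q eps 0 = 0 and its
   inverse is 0 too: dividing by the temperature at time 0 gives 0, which is
   the convention 1/T(0) = 0. *)
Definition temperature U Q (eps t : R) : R := (c_M2 U Q + eps) / ln (t + 1).

Definition M2_rate U Q T x y : R :=
  Q x y * Num.max 1 (expR ((U x - U y) / T)).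

Definition M2 U Q T x y : R :=
  if x == y then - \sum_(z | z != x) M2_rate U Q T x z
  else M2_rate U Q T x y.

(* P s t x y, for 0 <= s <= t, are the transition probabilities of the chain
   with generators (M t)_(t >= 0), characterised by the forward equation
   d/dt P_(s,t) = P_(s,t) M_t, P_(s,s) = I. The values of P outside of
   0 <= s <= t are unconstrained, hence the one-sided condition at t = s. *)
Definition transition_semigroup (M : R -> X -> X -> R)
    (P : R -> R -> X -> X -> R) : Prop :=
  forall s, 0 <= s -> forall x y,
  [/\ P s s x y = (x == y)%:R,
      P s t x y @[t --> s^'+] --> P s s x y
    & forall t, s < t ->
        is_derive t 1 (fun u => P s u x y) (\sum_z P s t x z * M t z y)].

Definition Gibbs_Z U pi T : R := \sum_x expR (- U x / T) * pi x.

Definition Gibbs U pi T x : R := expR (- U x / T) * pi x / Gibbs_Z U pi T.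

Definition U_min U : pred X := [pred x | [forall y, U x <= U y]].

Definition pi_min U pi x : R :=
  if x \in U_min U then pi x / \sum_(y in U_min U) pi y else 0.

Definition TV mu nu : R := 2^-1 * \sum_x `|mu x - nu x|.

(* The convention 0 * log 0 = 0 is automatic. *)
Definition Ent nu mu : R := \sum_x mu x * ln (mu x / nu x).

End Defs.

(* Main.v *)
Require Import Defs.
From HB Require Import structures.
From mathcomp Require Import all_boot all_order all_algebra.
From mathcomp Require Import all_classical all_reals all_analysis.
From mathcomp Require Import ring lra.

Set Implicit Arguments.
Unset Strict Implicit.
Unset Printing Implicit Defensive.

Import Order.TTheory GRing.Theory Num.Theory.
Import numFieldNormedType.Exports.

Local Open Scope classical_set_scope.
Local Open Scope ring_scope.

(** The chain at inverse temperature b is reversible with respect to the Gibbs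
    distribution, and, up to the factor 1/Z, its conductances are
    pi(x) Q(x,y) e^(-b min(U x, U y)):
    the acceptance factor max(1, e^(b(U x - U y))) turns the Boltzmann weight
    e^(-bU x) of the starting point into that of the lower of the two
    endpoints. This is why elevations of paths are measured by
    min(U(a), U(b)) along their edges.

    Joining each pair x, y by a nearly optimal path (comparison of
    e^(-b(U x + U y)) with the smallest conductance e^(-b Elev2) on the path)
    gives a Poincare inequality with constant of order e^(b c), where c is
    [c_M2] up to an arbitrarily small loss ([poincare_M2]). The loss is
    harmless since the cooling schedule has a margin eps.

    The quantity that is followed in time is the chi-square divergence of the
    law of the chain from the instantaneous Gibbs distribution. The generator
    makes it decrease at a rate at least e^(-b c) up to a constant, while the
    change of b perturbs it by at most b' (sup U) (chi2 + 1)
    ([chi2_rate_le]). With b = log(t+1)/(c_M2 + eps), b' is of order 1/(t+1),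
    whereas e^(-b (c_M2 + eps/2)) is 1/(t+1) times the unbounded factor
    e^(b eps/2). Hence (t+1) chi2' <= B - n chi2 for large t, for every n,
    which forces chi2 to tend to 0 ([poly_decay_cvg0], [chi2_cvg0]).

    Both conclusions follow: sqrt chi2 bounds the pointwise distance to the
    Gibbs distribution, which itself converges to pi_min, and the relative
    entropy is bounded by a multiple of sqrt chi2 + chi2 ([Ent_Gibbs_le]). *)

(** * Dirichlet forms and variances *)

Definition dirichlet_form (R : realType) (X : finType) (w : X -> X -> R)
    (h : X -> R) : R :=
  2^-1 * \sum_x \sum_y w x y * (h x - h y) ^+ 2.

(** Integration by parts. Expanding the square (h x - h y)^2 against the
    symmetric kernel m M, the two diagonal contributions vanish because the
    rows of M, hence also the columns of m M, sum to zero. *)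
Lemma dirichlet_form_generator (R : realType) (X : finType)
    (m : X -> R) (M : X -> X -> R) (h : X -> R) :
  (forall x y, m x * M x y = m y * M y x) -> (forall x, \sum_y M x y = 0) ->
  \sum_y h y * (\sum_x m x * h x * M x y) =
  - dirichlet_form (fun x y => m x * M x y) h.
Proof.
move=> mM M0; rewrite /dirichlet_form.
have sq x y : m x * M x y * (h x - h y) ^+ 2 =
    m x * h x ^+ 2 * M x y + m y * h y ^+ 2 * M y x
    - 2 * (h y * (m x * h x * M x y)).
  by transitivity (m x * M x y * h x ^+ 2 + m x * M x y * h y ^+ 2
       - 2 * (h y * (m x * h x * M x y))); [ring|rewrite {2}mM; ring].
have S1 : \sum_x \sum_y m x * h x ^+ 2 * M x y = 0.
  by rewrite big1 // => x _; rewrite -mulr_sumr M0 mulr0.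
have S2 : \sum_x \sum_y m y * h y ^+ 2 * M y x = 0 by rewrite exchange_big.
have -> : \sum_x \sum_y m x * M x y * (h x - h y) ^+ 2 =
    - (2 * \sum_x \sum_y h y * (m x * h x * M x y)).
  rewrite -[RHS]add0r -[X in X - _]addr0 -[X in X + _ - _]S1 -[X in _ + X - _]S2.
  rewrite mulr_sumr.
  rewrite -big_split -sumrB; apply: eq_bigr => x _ /=.
  rewrite mulr_sumr -big_split -sumrB; apply: eq_bigr => y _ /=.
  exact: sq.
under eq_bigr => y _ do rewrite mulr_sumr.
by rewrite exchange_big/=; lra.
Qed.

(** For weights m of total mass Z, the right-hand side is Z^2 times the variance
    of h under m/Z. *)
Lemma variance_pairs (R : realType) (X : finType) (m h : X -> R) :
  2^-1 * \sum_x \sum_y m x * m y * (h x - h y) ^+ 2 =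
  (\sum_x m x) * (\sum_x m x * h x ^+ 2) - (\sum_x m x * h x) ^+ 2.
Proof.
have sq x y : m x * m y * (h x - h y) ^+ 2 =
    (m x * h x ^+ 2) * m y + m x * (m y * h y ^+ 2)
    - 2 * ((m x * h x) * (m y * h y)) by ring.
under eq_bigr => x _.
  under eq_bigr => y _ do rewrite sq.
  rewrite sumrB big_split/= -!mulr_sumr.
  over.
rewrite sumrB big_split/= -!mulr_suml -!mulr_sumr -mulr_suml.
by rewrite expr2; lra.
Qed.

(** * Poincare inequality from elevations of paths *)

Definition boltzmann (R : realType) (X : finType) (U pi : X -> R) (b : R)
    (x : X) : R :=
  expR (- (b * U x)) * pi x.

(** Off the diagonal and for b >= 0, this is [boltzmann U pi b x] times the
    transition rate from x to y (see [boltzmann_M2]), written in a visibly symmetric form. *)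
Definition conductance (R : realType) (X : finType) (U : X -> R)
    (Q : X -> X -> R) (pi : X -> R) (b : R) (x y : X) : R :=
  pi x * Q x y * expR (- (b * Num.min (U x) (U y))).

(** Detailed balance transports positivity along each edge of a path. *)
Lemma stationary_gt0 (R : realType) (X : finType) (Q : X -> X -> R)
    (pi : X -> R) :
  ergodic Q -> stationary Q pi -> reversible Q pi -> forall x, 0 < pi x.
Proof.
move=> irr [[pi_ge0 pi1] _] rev y.
have [x pix] : exists x, 0 < pi x.
  apply: contrapT => nex; suff : \sum_x pi x = 0.
    by rewrite pi1 => /eqP; rewrite oner_eq0.
  apply: big1 => x _; apply/eqP; rewrite eq_le pi_ge0 andbT leNgt.
  by apply/negP => ?; apply: nex; exists x.
have [p [pth <-]] := irr x y.
elim: p x pix pth => [//|z p IH] x pix /= /andP[Qxz pth].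
apply: IH => //; have := mulr_gt0 pix Qxz.
rewrite rev => pQ; rewrite lt_def pi_ge0 andbT.
by apply: contraTneq pQ => ->; rewrite mul0r ltxx.
Qed.

Lemma seqmax_ub (R : realType) (s : seq R) a : a \in s -> a <= seqmax s.
Proof. by move=> sa; apply: le_bigmax_seq. Qed.

Lemma Elev2_ge0 (R : realType) (X : finType) (U : X -> R) x p :
  (forall x, 0 <= U x) -> 0 <= Elev2 U x p.
Proof.
move=> U0; case: p => [|y p]; first by rewrite /Elev2 /seqmax big_nil.
apply: (@le_trans _ _ (Num.min (U x) (U y))); first by rewrite le_min !U0.
by apply: seqmax_ub; rewrite /= mem_head.
Qed.

Lemma edge_le_dirichlet_form (R : realType) (X : finType) (w : X -> X -> R)
    (h : X -> R) x y :
  (forall x y, x != y -> 0 <= w x y) ->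
  w x y * (h x - h y) ^+ 2 <= 2 * dirichlet_form w h.
Proof.
move=> w0; rewrite /dirichlet_form [leRHS]mulrA divff ?mul1r ?pnatr_eq0//.
have t0 a c : 0 <= w a c * (h a - h c) ^+ 2.
  have [->|ac] := eqVneq a c; first by rewrite subrr expr0n mulr0.
  by rewrite mulr_ge0 ?sqr_ge0 ?w0.
rewrite (bigD1 x)//= (bigD1 y)//= -addrA lerDl addr_ge0 ?sumr_ge0// => a _.
exact: sumr_ge0.
Qed.

Lemma dirichlet_form_ge0 (R : realType) (X : finType) (w : X -> X -> R)
    (h : X -> R) :
  (forall x y, x != y -> 0 <= w x y) -> 0 <= dirichlet_form w h.
Proof.
move=> w0; rewrite /dirichlet_form mulr_ge0 ?invr_ge0//.
apply: sumr_ge0 => x _; apply: sumr_ge0 => y _.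
have [->|xy] := eqVneq x y; first by rewrite subrr expr0n mulr0.
by rewrite mulr_ge0 ?sqr_ge0 ?w0.
Qed.

Lemma conductance_ge0 (R : realType) (X : finType) (U : X -> R)
    (Q : X -> X -> R) (pi : X -> R) b x y :
  is_generator Q -> (forall x, 0 < pi x) -> x != y ->
  0 <= conductance U Q pi b x y.
Proof.
by move=> [Q0 _] pi0 xy; rewrite /conductance !mulr_ge0 ?expR_ge0 ?Q0// ltW.
Qed.

(** Each edge of the path has conductance at least a constant times e^(-bL), so
    its squared increment is controlled by the Dirichlet form. The constant C
    depends on the path but on neither b nor h; squares of sums are split
    crudely by (u+v)^2 <= 2u^2 + 2v^2, since only the exponential dependence
    on b matters. *)
Lemma path_le_dirichlet_form (R : realType) (X : finType) (U : X -> R)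
    (Q : X -> X -> R) (pi : X -> R) (L : R) (x : X) (p : seq X) :
  is_generator Q -> (forall x, 0 < pi x) ->
  path (fun a b => 0 < Q a b) x p ->
  all (fun e => e <= L) (pairmap (fun a b => Num.min (U a) (U b)) x p) ->
  exists2 C : R, 0 <= C & forall (b : R) (h : X -> R), 0 <= b ->
    (h x - h (last x p)) ^+ 2 <=
    C * (expR (b * L) * dirichlet_form (conductance U Q pi b) h).
Proof.
move=> gen pi0; elim: p x => [|y p IH] x /=.
  by move=> _ _; exists 0 => // b h _; rewrite subrr expr0n mul0r.
move=> /andP[Qxy pth] /andP[xyL /(IH _ pth)[C C0 hC]].
have q0 : 0 < pi x * Q x y by rewrite mulr_gt0.
exists (2 * (2 / (pi x * Q x y)) + 2 * C).
  by rewrite addr_ge0 ?mulr_ge0 ?invr_ge0// ltW.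
move=> b h b0; have {}hC := hC b h b0.
set D := dirichlet_form _ _ in hC *.
have edge : (h x - h y) ^+ 2 <= 2 / (pi x * Q x y) * (expR (b * L) * D).
  have /= wxy := @edge_le_dirichlet_form R X (conductance U Q pi b) h x y
    (fun x y => @conductance_ge0 R X U Q pi b x y gen pi0).
  rewrite mulrAC ler_pdivlMr// mulrC.
  have -> : pi x * Q x y * (h x - h y) ^+ 2 =
      expR (b * Num.min (U x) (U y)) *
      (conductance U Q pi b x y * (h x - h y) ^+ 2).
    rewrite /conductance -[LHS]mulr1.
    rewrite -(expRxMexpNx_1 (b * Num.min (U x) (U y))).
    by set e := expR _; set e' := expR _; ring.
  rewrite [leRHS]mulrCA.
  apply: ler_pM => //; last by rewrite ler_expR ler_wpM2l.
  have [->|xy] := eqVneq x y; first by rewrite subrr expr0n mulr0.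
  by rewrite mulr_ge0 ?sqr_ge0// conductance_ge0.
have sq2 (u v : R) : (u + v) ^+ 2 <= 2 * u ^+ 2 + 2 * v ^+ 2.
  by have := sqr_ge0 (u - v); nra.
rewrite -[h x - h _](subrKA (h y)) (le_trans (sq2 _ _))// [leRHS]mulrDl -![in leRHS]mulrA.
by apply: lerD; rewrite ler_wpM2l// mulrA.
Qed.

(** H2(x,y) is an infimum, so some path has elevation below H2(x,y) + eta; along
    it, the weight e^(-b(U x + U y)) of the
    pair absorbs all but e^(b(c_M2 + eta)) of the factor e^(b Elev2). *)
Lemma poincare_M2 (R : realType) (X : finType) (U : X -> R)
    (Q : X -> X -> R) (pi : X -> R) (eta : R) :
  (forall x, 0 <= U x) -> is_generator Q -> ergodic Q ->
  (forall x, 0 < pi x) -> 0 < eta ->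
  exists2 K : R, 0 < K & forall (b : R) (h : X -> R), 0 <= b ->
    (\sum_x boltzmann U pi b x) * (\sum_x boltzmann U pi b x * h x ^+ 2)
      - (\sum_x boltzmann U pi b x * h x) ^+ 2 <=
    K * (expR (b * (c_M2 U Q + eta)) *
         dirichlet_form (conductance U Q pi b) h).
Proof.
move=> U0 gen irr pi0 eta0.
have D0 b h : 0 <= dirichlet_form (conductance U Q pi b) h.
  by apply: dirichlet_form_ge0 => x y; exact: conductance_ge0.
have pair (xy : X * X) : exists2 K : R, 0 <= K & forall b h, 0 <= b ->
    boltzmann U pi b xy.1 * boltzmann U pi b xy.2 * (h xy.1 - h xy.2) ^+ 2 <=
    K * (expR (b * (c_M2 U Q + eta)) *
         dirichlet_form (conductance U Q pi b) h).
  case: xy => x y /=; have [->|xy] := eqVneq x y.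
    by exists 0 => // b h _; rewrite subrr expr0n mulr0 mul0r.
  have [p [pth lastp] pH] : exists2 p, is_path Q x y p &
      Elev2 U x p < H2 U Q x y + eta.
    have infH : has_inf [set Elev2 U x p | p in [set p | is_path Q x y p]].
      split; first by have [p px] := irr x y; exists (Elev2 U x p), p.
      by exists 0 => _ [p _ <-]; exact: Elev2_ge0.
    by have [_ [p px <-] ?] := inf_adherent eta0 infH; exists p.
  have cH : H2 U Q x y - U x - U y <= c_M2 U Q.
    apply/seqmax_ub/mapP; exists (x, y) => //.
    by rewrite mem_enum inE.
  have /(path_le_dirichlet_form gen pi0 pth)[C C0 hC] :
      all (fun e => e <= H2 U Q x y + eta)
          (pairmap (fun a b => Num.min (U a) (U b)) x p).
    by apply/allP => e /seqmax_ub /le_trans; apply; exact: ltW.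
  exists (pi x * pi y * C); first by rewrite !mulr_ge0// ltW.
  move=> b h b0; have {hC} := hC b h b0; rewrite lastp => hC.
  have -> : boltzmann U pi b x * boltzmann U pi b y * (h x - h y) ^+ 2 =
      pi x * pi y * (expR (- (b * (U x + U y))) * (h x - h y) ^+ 2).
    by rewrite /boltzmann mulrDr opprD expRD; ring.
  rewrite -[leRHS]mulrA ler_wpM2l ?mulr_ge0 ?(ltW (pi0 _))//.
  apply: (le_trans (ler_wpM2l (expR_ge0 _) hC)).
  rewrite mulrCA ler_wpM2l// mulrA -expRD ler_wpM2r// ler_expR.
  by rewrite -mulrN -mulrDr ler_wpM2l//; lra.
have [K K0 hK] := fin_all_exists2 pair.
exists (1 + 2^-1 * \sum_x \sum_y K (x, y)).
  rewrite ltr_pwDl// mulr_ge0 ?invr_ge0//.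
  by apply: sumr_ge0 => x _; apply: sumr_ge0 => y _.
move=> b h b0; rewrite -variance_pairs.
set E := expR _ * _; have E0 : 0 <= E by rewrite mulr_ge0 ?expR_ge0.
rewrite [leRHS]mulrDl mul1r [leRHS]addrC ler_wpDr//.
rewrite -[leRHS]mulrA ler_wpM2l ?invr_ge0// [leRHS]mulr_suml.
apply: ler_sum => x _; rewrite [leRHS]mulr_suml.
by apply: ler_sum => y _; exact: (hK (x, y)).
Qed.

(** * A decay criterion at infinity *)

Lemma is_derive_bigsum (R : realType) (X : finType) (f : X -> R -> R)
    (df : X -> R) (t : R) :
  (forall x, is_derive t 1 (f x) (df x)) ->
  is_derive t 1 (fun u => \sum_x f x u) (\sum_x df x).
Proof.
move=> fE; elim: (index_enum X) => [|x r IH].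
  rewrite big_nil; under eq_fun do rewrite big_nil.
  exact: is_derive_cst.
rewrite big_cons; under eq_fun do rewrite big_cons.
exact: is_deriveD.
Qed.

(** The inequality says that (t+1)^n (f t - B/n) is eventually nonincreasing,
    so that limsup f <= B/n, and n is arbitrary. *)
Lemma poly_decay_cvg0 (R : realType) (f df : R -> R) (s B : R) :
  0 <= s ->
  (forall t, s < t -> is_derive t 1 f (df t)) ->
  (forall t, s < t -> 0 <= f t) ->
  (forall n : nat, exists A, forall t, A < t -> s < t ->
     (t + 1) * df t <= B - n%:R * f t) ->
  f t @[t --> +oo] --> 0.
Proof.
move=> s0 fE f0 fn; apply/cvgr0Pnorm_lt => e e0.
(* The exponent n.+1 below makes the residual level B / n.+1 small. *)
have [n Bn] : exists n : nat, B / n.+1%:R < e / 2.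
  exists (Num.truncn (B / (e / 2))).
  rewrite ltr_pdivrMr// mulrC -ltr_pdivrMr ?divr_gt0//.
  exact: truncnS_gt.
have [A hA] := fn n.+1.
pose a := Num.max A s.
pose G t := (t + 1) ^+ n.+1 * (f t - B / n.+1%:R).
have GE t : a < t -> is_derive t 1 G
    ((t + 1) ^+ n * (n.+1%:R * f t - B + (t + 1) * df t)).
  rewrite gt_max => /andP[At st]; have dft := fE t st.
  have d1 : is_derive t 1 (fun t => t + 1) (1 : R).
    by apply: is_derive_eq; rewrite addr0.
  have d2 : is_derive t 1 (fun t => (t + 1) ^+ n.+1) (n.+1%:R * (t + 1) ^+ n).
    by have := is_deriveX n.+1 d1; rewrite exprfctE /GRing.scale/= mulr1.
  have d3 : is_derive t 1 (fun t => f t - B / n.+1%:R) (df t).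
    by apply: is_derive_eq; rewrite subr0.
  apply: (is_derive_eq (is_deriveM d2 d3)); rewrite /GRing.scale/= exprS.
  set q := (t + 1) ^+ n.
  by field; rewrite nat1r pnatr_eq0.
have GD t : a + 1 <= t -> derivable G t 1.
  move=> at1; have at0 : a < t by rewrite (lt_le_trans _ at1)// ltrDl.
  by have [] := GE t at0.
have Gle t : a + 1 <= t -> G t <= G (a + 1).
  move=> at1; apply: (@ler0_derive1_nincry R G (a + 1)) => //.
  - by move=> u; rewrite in_itv/= andbT => /ltW; exact: GD.
  - move=> u; rewrite in_itv/= andbT => au.
    have au' : a < u by lra.
    rewrite derive1E (@derive_val _ _ _ _ _ _ _ (GE u au')).
    move: au'; rewrite gt_max => /andP[Au su].
    have := hA u Au su; have u1 : 0 <= u + 1 by lra.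
    move=> hu; rewrite mulr_ge0_le0 ?exprn_ge0//.
    by rewrite addrC -lerBrDr sub0r opprB.
  - apply: derivable_within_continuous => u.
    by rewrite in_itv/= andbT; exact: GD.
have a0 : 0 <= a by rewrite le_max s0 orbT.
near=> t.
have t0 : 0 < t by near: t; exact: nbhs_pinfty_gt.
have at1 : a + 1 <= t by near: t; apply: nbhs_pinfty_ge; exact: num_real.
have st : s < t.
  by rewrite (lt_le_trans _ at1)// ltr_pwDr// le_max lexx orbT.
have Gt : `|G (a + 1)| < t * (e / 2).
  rewrite -ltr_pdivrMr ?divr_gt0//.
  by near: t; apply: nbhs_pinfty_gt; exact: num_real.
rewrite ger0_norm ?f0//.
suff ft : f t - B / n.+1%:R < e / 2.
  by have := ltrD ft Bn; rewrite subrK -splitr.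
have p0 : 0 < (t + 1) ^+ n.+1 by rewrite exprn_gt0// addr_gt0.
rewrite -(ltr_pM2l p0); apply: (le_lt_trans (Gle t at1)).
apply: (le_lt_trans (ler_norm _)); apply: (lt_le_trans Gt).
rewrite ler_pM2r ?divr_gt0//.
rewrite exprS -[leLHS]mulr1 ler_pM ?lerDl ?(ltW t0)//.
by rewrite exprn_ege1// lerDr (ltW t0).
Unshelve. all: by end_near. Qed.

(** * The chi-square divergence from the Gibbs distribution *)

Lemma boltzmann_gt0 (R : realType) (X : finType) (U pi : X -> R) b x :
  (forall x, 0 < pi x) -> 0 < boltzmann U pi b x.
Proof. by move=> pi0; rewrite mulr_gt0 ?expR_gt0. Qed.

Lemma conductanceC (R : realType) (X : finType) (U : X -> R)
    (Q : X -> X -> R) (pi : X -> R) b x y :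
  reversible Q pi -> conductance U Q pi b x y = conductance U Q pi b y x.
Proof. by move=> rev; rewrite /conductance rev minC. Qed.

Lemma boltzmann_M2 (R : realType) (X : finType) (U : X -> R)
    (Q : X -> X -> R) (pi : X -> R) T x y :
  0 <= T^-1 -> x != y ->
  boltzmann U pi T^-1 x * M2 U Q T x y = conductance U Q pi T^-1 x y.
Proof.
move=> b0 xy; rewrite /M2 (negPf xy) /M2_rate /boltzmann /conductance.
set b := T^-1; have [Uxy|/ltW Uyx] := leP (U x) (U y).
  rewrite max_l; first by ring.
  by rewrite -expR0 ler_expR mulr_le0_ge0// subr_le0.
rewrite max_r; last by rewrite -[leLHS]expR0 ler_expR mulr_ge0// subr_ge0.
transitivity (pi x * Q x y * (expR (- (b * U x)) * expR ((U x - U y) * b))).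
  by ring.
by rewrite -expRD; congr (_ * expR _); ring.
Qed.

Lemma sum_M2 (R : realType) (X : finType) (U : X -> R) (Q : X -> X -> R) T x :
  \sum_y M2 U Q T x y = 0.
Proof.
rewrite (bigD1 x)//= {1}/M2 eqxx addrC; apply/eqP; rewrite subr_eq0; apply/eqP.
by apply: eq_bigr => y; rewrite eq_sym /M2 => /negPf ->.
Qed.

(** The chi-square divergence sum (mu - g)^2 / g from the Gibbs distribution g
    at inverse temperature b (see [chi2E]); this form is the easiest one to
    differentiate in b. *)
Definition chi2 (R : realType) (X : finType) (U pi : X -> R) (b : R)
    (mu : X -> R) : R :=
  (\sum_x boltzmann U pi b x) * (\sum_x mu x ^+ 2 / boltzmann U pi b x) - 1.

(** The derivative of [chi2] along a curve (b, mu) of velocity (db, dmu). *)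
Definition chi2_rate (R : realType) (X : finType) (U pi : X -> R) (b db : R)
    (mu dmu : X -> R) : R :=
  - db * (\sum_x U x * boltzmann U pi b x) *
    (\sum_x mu x ^+ 2 / boltzmann U pi b x) +
  (\sum_x boltzmann U pi b x) *
    (2 * (\sum_x mu x * dmu x / boltzmann U pi b x) +
     db * (\sum_x U x * (mu x ^+ 2 / boltzmann U pi b x))).

Lemma is_derive_chi2 (R : realType) (X : finType) (U pi : X -> R)
    (b : R -> R) (db : R) (mu : R -> X -> R) (dmu : X -> R) (t : R) :
  (forall x, 0 < pi x) -> is_derive t 1 b db ->
  (forall x, is_derive t 1 (fun u => mu u x) (dmu x)) ->
  is_derive t 1 (fun u => chi2 U pi (b u) (mu u))
    (chi2_rate U pi (b t) db (mu t) dmu).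
Proof.
move=> pi0 bE muE.
have mE x : is_derive t 1 (fun u => boltzmann U pi (b u) x)
    (- db * (U x * boltzmann U pi (b t) x)).
  rewrite /boltzmann.
  have e1 : is_derive t 1 (fun u => - (b u * U x)) (- (db * U x)).
    apply: (is_derive_eq (is_deriveN (is_deriveM bE (is_derive_cst (U x) t 1)))).
    by rewrite /GRing.scale/= /cst/= mulr0 add0r mulrC.
  have e2 := is_derive1_comp (is_derive_expR _) e1.
  apply: (is_derive_eq (is_deriveM e2 (is_derive_cst (pi x) t 1))).
  by rewrite /GRing.scale/= /cst/=; ring.
have hE x : is_derive t 1 (fun u => mu u x ^+ 2 / boltzmann U pi (b u) x)
    (2 * (mu t x * dmu x / boltzmann U pi (b t) x) +
     db * (U x * (mu t x ^+ 2 / boltzmann U pi (b t) x))).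
  have m0 : boltzmann U pi (b t) x != 0 by rewrite gt_eqF// boltzmann_gt0.
  have e1 : is_derive t 1 (fun u => mu u x ^+ 2) (2 * (mu t x * dmu x)).
    apply: (is_derive_eq (is_deriveM (muE x) (muE x))).
    by rewrite /GRing.scale/=; ring.
  have e2 : is_derive t 1 (fun u => (boltzmann U pi (b u) x)^-1)
      (db * (U x / boltzmann U pi (b t) x)).
    have := @is_deriveV _ (fun u => boltzmann U pi (b u) x) t _ 1 m0 (mE x).
    set d := (X in is_derive _ _ _ X) => dV.
    have -> : db * (U x / boltzmann U pi (b t) x) = d; last exact: dV.
    by rewrite /d /GRing.scale/=; field.
  apply: (is_derive_eq (is_deriveM e1 e2)); rewrite /GRing.scale/=.
  by field.
have ZE := is_derive_bigsum mE; have AE := is_derive_bigsum hE.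
have PE := is_deriveM ZE AE.
have := is_deriveB PE (is_derive_cst (1 : R) t 1).
set d := (X in is_derive _ _ _ X) => CE.
suff <- : d = chi2_rate U pi (b t) db (mu t) dmu by exact: CE.
rewrite /d subr0 /GRing.scale/= /chi2_rate big_split/= -!mulr_sumr.
by ring.
Qed.

Lemma GibbsE (R : realType) (X : finType) (U pi : X -> R) T x :
  Gibbs U pi T x = boltzmann U pi T^-1 x / \sum_y boltzmann U pi T^-1 y.
Proof.
have bE y : expR (- U y / T) * pi y = boltzmann U pi T^-1 y.
  by rewrite /boltzmann mulNr [U y / _]mulrC.
by rewrite /Gibbs /Gibbs_Z bE; under eq_bigr do rewrite bE.
Qed.

Lemma sum_boltzmann_gt0 (R : realType) (X : finType) (U pi : X -> R) b (x : X) :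
  (forall x, 0 < pi x) -> 0 < \sum_y boltzmann U pi b y.
Proof.
move=> pi0; rewrite (bigD1 x)//= ltr_pwDl ?boltzmann_gt0//.
by apply: sumr_ge0 => y _; rewrite ltW// boltzmann_gt0.
Qed.

Lemma Gibbs_gt0 (R : realType) (X : finType) (U pi : X -> R) T x :
  (forall x, 0 < pi x) -> 0 < Gibbs U pi T x.
Proof.
by move=> pi0; rewrite GibbsE divr_gt0 ?boltzmann_gt0// sum_boltzmann_gt0.
Qed.

Lemma Gibbs_sum1 (R : realType) (X : finType) (U pi : X -> R) T (x : X) :
  (forall x, 0 < pi x) -> \sum_y Gibbs U pi T y = 1.
Proof.
move=> pi0; under eq_bigr do rewrite GibbsE.
by rewrite -mulr_suml divff// gt_eqF// sum_boltzmann_gt0.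
Qed.

Lemma chi2E (R : realType) (X : finType) (U pi : X -> R) T (mu : X -> R)
    (x : X) :
  (forall x, 0 < pi x) -> \sum_y mu y = 1 ->
  chi2 U pi T^-1 mu = \sum_y (mu y - Gibbs U pi T y) ^+ 2 / Gibbs U pi T y.
Proof.
move=> pi0 mu1; set g := Gibbs U pi T.
have sq y : (mu y - g y) ^+ 2 / g y = mu y ^+ 2 / g y - 2 * mu y + g y.
  by field; rewrite gt_eqF// Gibbs_gt0.
under eq_bigr do rewrite sq.
rewrite big_split sumrB/= -mulr_sumr mu1 Gibbs_sum1//.
have -> : \sum_y mu y ^+ 2 / g y = chi2 U pi T^-1 mu + 1.
  rewrite /chi2 subrK mulr_sumr; apply: eq_bigr => y _.
  by rewrite /g GibbsE invf_div mulrCA.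
by ring.
Qed.

Lemma chi2_ge0 (R : realType) (X : finType) (U pi : X -> R) T (mu : X -> R)
    (x : X) :
  (forall x, 0 < pi x) -> \sum_y mu y = 1 -> 0 <= chi2 U pi T^-1 mu.
Proof.
move=> pi0 mu1; rewrite (chi2E U T x)//; apply: sumr_ge0 => y _.
by rewrite divr_ge0 ?sqr_ge0// ltW// Gibbs_gt0.
Qed.

(** In this form, with h the density of mu with respect to the unnormalised
    weights, [chi2] is bounded by the Poincare inequality. *)
Lemma chi2_variance (R : realType) (X : finType) (U pi : X -> R) b
    (mu : X -> R) :
  (forall x, 0 < pi x) -> \sum_y mu y = 1 ->
  let h y := mu y / boltzmann U pi b y in
  chi2 U pi b mu =
  (\sum_x boltzmann U pi b x) * (\sum_x boltzmann U pi b x * h x ^+ 2)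
      - (\sum_x boltzmann U pi b x * h x) ^+ 2.
Proof.
move=> pi0 mu1 h; have m0 x : boltzmann U pi b x != 0.
  by rewrite gt_eqF// boltzmann_gt0.
have -> : \sum_x boltzmann U pi b x * h x = 1.
  by rewrite -mu1; apply: eq_bigr => x _; rewrite /h mulrC divfK ?m0.
rewrite /chi2 expr1n; congr (_ * _ - _); apply: eq_bigr => x _.
by rewrite /h; field.
Qed.

(** By integration by parts the forward equation contributes -2 Z times the
    Dirichlet form of the density mu/m, which the Poincare inequality compares
    with [chi2]; the partition function Z is at least pi x0, since U x0 = 0.
    Moving b contributes b' (U - <U>) inside the sum defining chi2 + 1, of
    which the part in <U> is nonpositive. *)
Lemma chi2_rate_le (R : realType) (X : finType) (U pi : X -> R)
    (Q : X -> X -> R) T db (V K c : R) (x0 : X) (mu dmu : X -> R) :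
  (forall x, 0 <= U x <= V) -> U x0 = 0 -> reversible Q pi ->
  is_generator Q ->
  (forall x, 0 < pi x) -> 0 <= T^-1 -> 0 <= db -> 0 < K ->
  (forall h : X -> R,
    (\sum_x boltzmann U pi T^-1 x) * (\sum_x boltzmann U pi T^-1 x * h x ^+ 2)
      - (\sum_x boltzmann U pi T^-1 x * h x) ^+ 2 <=
    K * (expR (T^-1 * c) * dirichlet_form (conductance U Q pi T^-1) h)) ->
  \sum_x mu x = 1 ->
  (forall y, dmu y = \sum_z mu z * M2 U Q T z y) ->
  chi2_rate U pi T^-1 db mu dmu <=
  db * V * (chi2 U pi T^-1 mu + 1) -
  2 * pi x0 / K * expR (- (T^-1 * c)) * chi2 U pi T^-1 mu.
Proof.
move=> UV Ux0 rev gen pi0; set b := T^-1 => b0 db0 K0 poinc mu1 dmuE.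
pose m := boltzmann U pi b; pose h y := mu y / m y.
have m0 x : 0 < m x by exact: boltzmann_gt0.
have hE x : m x * h x = mu x by rewrite /h mulrC divfK// gt_eqF.
pose D := dirichlet_form (conductance U Q pi b) h.
have mM x y : x != y -> m x * M2 U Q T x y = conductance U Q pi b x y.
  exact: boltzmann_M2.
have energy : \sum_x mu x * dmu x / m x = - D.
  transitivity (\sum_y h y * (\sum_x m x * h x * M2 U Q T x y)).
    apply: eq_bigr => y _; rewrite dmuE mulrAC; congr (_ * _).
    by apply: eq_bigr => z _; rewrite hE.
  rewrite dirichlet_form_generator; last exact: sum_M2.
    congr (- (_ * _)); apply: eq_bigr => x _; apply: eq_bigr => y _.
    have [->|xy] := eqVneq x y; first by rewrite subrr expr0n !mulr0.
    by rewrite mM.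
  move=> x y; have [->//|xy] := eqVneq x y.
  by rewrite !mM// 1?eq_sym// conductanceC.
have Z0 : pi x0 <= \sum_x m x.
  rewrite (bigD1 x0)//= {1}/m /boltzmann Ux0 mulr0 oppr0 expR0 mul1r lerDl.
  by apply: sumr_ge0 => x _; exact: ltW.
set Z := \sum_x m x in Z0.
set A := \sum_x mu x ^+ 2 / m x.
have ZA : chi2 U pi b mu + 1 = Z * A by rewrite /chi2 subrK.
have a0 x : 0 <= mu x ^+ 2 / m x by rewrite divr_ge0 ?sqr_ge0// ltW.
have UA : \sum_x U x * (mu x ^+ 2 / m x) <= V * A.
  rewrite mulr_sumr; apply: ler_sum => x _; rewrite ler_wpM2r//.
  by have /andP[] := UV x.
have UM : 0 <= \sum_x U x * m x.
  apply: sumr_ge0 => x _; rewrite mulr_ge0 ?(ltW (m0 x))//.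
  by have /andP[] := UV x.
have A0 : 0 <= A by exact: sumr_ge0.
have Zp : 0 <= Z by apply: le_trans Z0; exact: ltW.
have D0 : 0 <= D by apply: dirichlet_form_ge0 => x y; exact: conductance_ge0.
have KD : K^-1 * expR (- (b * c)) * chi2 U pi b mu <= D.
  have := poinc h; rewrite -(chi2_variance U b pi0 mu1) -/D => /(ler_wpM2l _).
  move=> /(_ (K^-1 * expR (- (b * c)))); rewrite mulr_ge0 ?invr_ge0 ?expR_ge0 ?(ltW K0)//.
  move=> /(_ isT) /le_trans; apply.
  have e1 := expRxMexpNx_1 (b * c).
  rewrite -[leRHS]mul1r -[in leRHS]e1.
  set e := expR (b * c); set e' := expR (- _).
  by have -> // : K^-1 * e' * (K * (e * D)) = e * e' * D
    by field; rewrite gt_eqF.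
rewrite /chi2_rate energy ZA.
have h1 : - db * (\sum_x U x * m x) * A <= 0.
  by rewrite !mulNr oppr_le0 !mulr_ge0.
have h2 : Z * (db * \sum_x U x * (mu x ^+ 2 / m x)) <= db * V * (Z * A).
  have -> : db * V * (Z * A) = Z * (db * (V * A)) by ring.
  by rewrite ler_wpM2l// ler_wpM2l.
have h3 : 2 * pi x0 / K * expR (- (b * c)) * chi2 U pi b mu <= Z * (2 * D).
  have -> : 2 * pi x0 / K * expR (- (b * c)) * chi2 U pi b mu =
    pi x0 * (2 * (K^-1 * expR (- (b * c)) * chi2 U pi b mu)) by ring.
  apply: (@le_trans _ _ (pi x0 * (2 * D))).
    by rewrite ler_wpM2l ?(ltW (pi0 _))// ler_wpM2l.
  by rewrite ler_wpM2r// mulr_ge0.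
rewrite [Z * (_ + _)]mulrDr !mulrN -[leRHS]add0r; apply: lerD => //.
by rewrite addrC lerB.
Qed.

(** * Convergence of the chi-square divergence along the chain *)

Lemma cvg_bigsum (R : realType) (X : finType) (P : pred X)
    (F : set_system R) (f : X -> R -> R) (l : X -> R) :
  Filter F -> (forall x, P x -> f x t @[t --> F] --> l x) ->
  \sum_(x | P x) f x t @[t --> F] --> \sum_(x | P x) l x.
Proof.
move=> FF fl; apply: cvg_big => //.
exact: add_continuous.
Qed.

(** The total mass has zero derivative after time s, and right-continuity at s
    ties the constant to its initial value 1. *)
Lemma transition_sum1 (R : realType) (X : finType) (M : R -> X -> X -> R)
    (P : R -> R -> X -> X -> R) (s t : R) (x : X) :
  (forall t x, \sum_y M t x y = 0) -> transition_semigroup M P ->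
  0 <= s -> s < t -> \sum_y P s t x y = 1.
Proof.
move=> M0 hP s0 st.
pose S u := \sum_y P s u x y.
have SE u : s < u -> is_derive u 1 S 0.
  move=> su.
  have PE y := let: And3 _ _ h := hP s s0 x y in h u su.
  apply: (is_derive_eq (is_derive_bigsum PE)).
  by rewrite exchange_big big1// => z _; rewrite -mulr_sumr M0 mulr0.
have Sconst u : s < u -> u < t -> S u = S t.
  move=> su ut; have [||c _] := @MVT R S (cst 0) u t ut.
  - move=> v; rewrite in_itv/= => /andP[uv _].
    by apply: SE; exact: lt_trans su uv.
  - apply: derivable_within_continuous => v; rewrite in_itv/= => /andP[uv _].
    by have [] := SE v (lt_le_trans su uv).
  by rewrite mul0r => /eqP; rewrite subr_eq0 => /eqP.
have S1 : S u @[u --> s^'+] --> (1 : R).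
  have -> : (1 : R) = \sum_y P s s x y.
    rewrite (bigD1 x)//=; have [-> _ _] := hP s s0 x x.
    rewrite eqxx big1 ?addr0// => y yx; have [-> _ _] := hP s s0 x y.
    by rewrite eq_sym (negPf yx).
  by apply: cvg_bigsum => y _; have [_ ? _] := hP s s0 x y.
have S2 : S u @[u --> s^'+] --> S t.
  apply: cvg_near_cst; near=> u; apply: Sconst.
    by near: u; exact: nbhs_right_gt.
  by near: u; exact: nbhs_right_lt.
exact: (cvg_unique _ S2 S1).
Unshelve. all: by end_near. Qed.

Lemma temperatureV (R : realType) (X : finType) (U : X -> R)
    (Q : X -> X -> R) eps t :
  (temperature U Q eps t)^-1 = ln (t + 1) / (c_M2 U Q + eps).
Proof. by rewrite /temperature invf_div. Qed.

(** The Poincare inequality is used with slack eta = eps/2. Since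
    t + 1 = e^(b(c_M2 + eps)), multiplying its rate e^(-b(c_M2 + eps/2)) by
    t + 1 leaves e^(b eps/2), which exceeds any prescribed n + B eventually. *)
Lemma chi2_cvg0 (R : realType) (X : finType) (U : X -> R)
    (Q : X -> X -> R) (pi : X -> R) (eps : R) (P : R -> R -> X -> X -> R)
    (s : R) (x : X) :
  (forall x, 0 <= U x) -> (exists x, U x = 0) ->
  is_generator Q -> ergodic Q -> stationary Q pi -> reversible Q pi ->
  0 < c_M2 U Q -> 0 < eps ->
  transition_semigroup (fun t => M2 U Q (temperature U Q eps t)) P ->
  0 <= s ->
  chi2 U pi (temperature U Q eps t)^-1 (P s t x) @[t --> +oo] --> 0.
Proof.
move=> U0 [x0 Ux0] gen irr stat rev c0 e0 hP s0.
have pi0 := stationary_gt0 irr stat rev.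
pose V := \sum_x U x.
have UV y : 0 <= U y <= V.
  rewrite U0/= /V (bigD1 y)//= lerDl; exact: sumr_ge0.
have V0 : 0 <= V by exact: sumr_ge0.
have [K K0 hK] := poincare_M2 U0 gen irr pi0 (divr_gt0 e0 (ltr0n R 2)).
set c := c_M2 U Q in c0 hK *; have ce0 : 0 < c + eps by rewrite addr_gt0.
pose b t := (temperature U Q eps t)^-1.
have bE t : b t = ln (t + 1) / (c + eps) by rewrite /b temperatureV.
pose db t := ((c + eps) * (t + 1))^-1.
have dbE t : s < t -> is_derive t 1 b (db t).
  move=> st; have t1 : 0 < t + 1 by rewrite addr_gt0// (le_lt_trans s0).
  have -> : b = (fun t => (ln (t + 1)) / (c + eps)) by apply/funext.
  have d1 : is_derive t 1 (fun t => t + 1) (1 : R).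
    by apply: is_derive_eq; rewrite addr0.
  have d2 := @is_derive1_comp _ (@ln R) (fun t => t + 1) t _ _ (is_derive1_ln t1) d1.
  apply: (is_derive_eq (is_deriveM d2 (is_derive_cst (c + eps)^-1 t 1))).
  by rewrite /GRing.scale/= /cst/= /db invfM mulr0 add0r mulr1.
pose dmu t y := \sum_z P s t x z * M2 U Q (temperature U Q eps t) z y.
pose d t := chi2_rate U pi (b t) (db t) (P s t x) (dmu t).
have sum1 t : s < t -> \sum_y P s t x y = 1.
  exact: (transition_sum1 x (fun u y => sum_M2 _ _ _ _) hP s0).
apply: (@poly_decay_cvg0 R _ d s (V / (c + eps))) => //.
- move=> t st; apply: is_derive_chi2 => //; first exact: dbE.
  by move=> y; have [_ _] := hP s s0 x y; apply.
- by move=> t st; apply: (chi2_ge0 U _ x pi0); exact: sum1.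
move=> n; pose B := V / (c + eps).
pose L := (n%:R + B) * K / (2 * pi x0).
(* Past this time b t (eps / 2) >= L, and e^L >= L suffices for key. *)
exists (expR ((2 * L / eps) * (c + eps))) => t At st.
have t1 : 0 < t + 1 by rewrite addr_gt0// (le_lt_trans s0).
have b0 : 0 <= b t.
  by rewrite bE divr_ge0 ?(ltW ce0)// ln_ge0// lerDr ltW// (le_lt_trans s0).
have db0 : 0 <= db t by rewrite invr_ge0 mulr_ge0// ltW.
have := chi2_rate_le UV Ux0 rev gen pi0 b0 db0 K0
  (fun h => hK (b t) h b0) (sum1 t st) (fun y => erefl (dmu t y)).
rewrite -/(b t) -/(d t); set f := chi2 _ _ _ _ => dle.
have f0 : 0 <= f by apply: (chi2_ge0 U _ x pi0); exact: sum1.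
have bL : L <= b t * (eps / 2).
  have t0 := le_lt_trans s0 st.
  have : 2 * L / eps <= b t.
    rewrite bE ler_pdivlMr// -ler_expR lnK ?posrE// (le_trans (ltW At))//.
    by rewrite lerDl.
  rewrite ler_pdivrMr// => /(ler_wpM2l (_ : 0 <= 2^-1)).
  by rewrite mulKf ?pnatr_eq0// => /(_ _)/le_trans; apply => //; lra.
have key : n%:R + B <=
    (t + 1) * (2 * pi x0 / K * expR (- (b t * (c + eps / 2)))).
  have tE : t + 1 = expR (b t * (c + eps)).
    by rewrite bE divfK ?gt_eqF// lnK.
  rewrite [X in X * _]tE mulrCA -expRD.
  have -> : b t * (c + eps) - b t * (c + eps / 2) = b t * (eps / 2) by lra.
  have -> : n%:R + B = 2 * pi x0 / K * L.
    by rewrite /L; field; rewrite !gt_eqF.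
  rewrite ler_wpM2l ?divr_ge0 ?mulr_ge0 ?(ltW (pi0 x0)) ?(ltW K0)//.
  apply: (le_trans bL); apply: le_trans (expR_ge1Dx _).
  by rewrite lerDr.
have tdb : (t + 1) * (db t * V) = B.
  by rewrite /db /B; field; rewrite !gt_eqF.
have := ler_wpM2l (ltW t1) dle; rewrite mulrBr mulrA tdb => /le_trans; apply.
have := ler_wpM2r f0 key; rewrite -[leRHS]mulrA [leLHS]mulrDl -/B.
rewrite [B * (f + 1)]mulrDr mulr1; set p := (t + 1) * _; set q := B * f.
by move=> h; lra.
Qed.

(** * From chi-square to total variation and entropy *)

(** Each term of the sum in [chi2E] is at most the whole; dropping the
    denominator, which is at most 1, gives the first bound. *)
Lemma Gibbs_sub_le (R : realType) (X : finType) (U pi : X -> R) T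
    (mu : X -> R) (y : X) :
  (forall x, 0 < pi x) -> \sum_x mu x = 1 ->
  `|mu y - Gibbs U pi T y| <= Num.sqrt (chi2 U pi T^-1 mu) /\
  (mu y - Gibbs U pi T y) ^+ 2 / Gibbs U pi T y <= chi2 U pi T^-1 mu.
Proof.
move=> pi0 mu1; set g := Gibbs U pi T.
have g0 z : 0 < g z by exact: Gibbs_gt0.
have h : (mu y - g y) ^+ 2 / g y <= chi2 U pi T^-1 mu.
  rewrite (chi2E _ _ y)// (bigD1 y)//= lerDl.
  by apply: sumr_ge0 => z _; rewrite divr_ge0 ?sqr_ge0// ltW.
split=> //; rewrite -sqrtr_sqr ler_wsqrtr// (le_trans _ h)//.
rewrite ler_pdivlMr// ler_piMr ?sqr_ge0//.
rewrite -(Gibbs_sum1 U T y pi0) (bigD1 y)//= lerDl.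
by apply: sumr_ge0 => z _; rewrite ltW.
Qed.

(** From 1 - 1/h <= ln h <= h - 1 for h > 0. It also holds for h <= 0, where
    [ln] is 0, so that densities of unknown sign are allowed. *)
Lemma norm_xlnx_le (R : realType) (h : R) :
  `|h * ln h| <= `|h - 1| + (h - 1) ^+ 2.
Proof.
have [h0|h0] := leP h 0; first by rewrite ln0// mulr0 normr0 addr_ge0 ?sqr_ge0.
have up : ln h <= h - 1.
  by rewrite -[X in ln X](subrKC 1) le_ln1Dx//; lra.
have lo : 1 - h^-1 <= ln h.
  suff : ln h^-1 <= h^-1 - 1 by rewrite lnV ?posrE//; lra.
  by rewrite -[X in ln X](subrKC 1) le_ln1Dx// ltrBrDl subrr invr_gt0.
have := ler_wpM2l (ltW h0) up; have := ler_wpM2l (ltW h0) lo.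
rewrite [X in X <= _ -> _]mulrBr mulr1 divff ?gt_eqF// => l1 l2.
have n1 := ler_norm (h - 1); have n2 := ler_norm (- (h - 1)).
rewrite normrN in n2; have := sqr_ge0 (h - 1).
by rewrite ler_norml; move: l1 l2 n1 n2; nra.
Qed.

Lemma temperatureV_cvgy (R : realType) (X : finType) (U : X -> R)
    (Q : X -> X -> R) eps :
  0 < c_M2 U Q + eps -> (temperature U Q eps t)^-1 @[t --> +oo] --> +oo.
Proof.
move=> c0; apply/cvgryPgt => A.
near=> t.
have t0 : 0 < t by near: t; exact: nbhs_pinfty_gt.
have tA : expR (A * (c_M2 U Q + eps)) < t.
  by near: t; apply: nbhs_pinfty_gt; exact: num_real.
rewrite temperatureV ltr_pdivlMr// -ltr_expR lnK ?posrE ?addr_gt0//.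
by rewrite (lt_trans tA)// ltrDl.
Unshelve. all: by end_near. Qed.

(** As b grows, the unnormalised weight e^(-b U) pi stays equal to pi where
    U = 0 and tends to 0 elsewhere. *)
Lemma Gibbs_cvg (R : realType) (X : finType) (U pi : X -> R) (T : R -> R) x0 :
  (forall x, 0 <= U x) -> U x0 = 0 -> (forall x, 0 < pi x) ->
  (T t)^-1 @[t --> +oo] --> +oo ->
  forall x, Gibbs U pi (T t) x @[t --> +oo] --> pi_min U pi x.
Proof.
move=> U0 Ux0 pi0 Ty x.
have minE y : (y \in U_min U) = (U y == 0).
  rewrite inE; apply/forallP/eqP => [|-> z]; last exact: U0.
  by move=> /(_ x0); rewrite Ux0 => ?; apply/eqP; rewrite eq_le U0 andbT.
pose l y := if y \in U_min U then pi y else 0.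
have bl y : boltzmann U pi (T t)^-1 y @[t --> +oo] --> l y.
  rewrite /boltzmann /l minE; have [Uy|Uy] := eqVneq (U y) 0.
    rewrite Uy; under eq_fun do rewrite mulr0 oppr0 expR0 mul1r.
    exact: cvg_cst.
  rewrite -[X in _ --> X](mul0r (pi y)); apply: cvgM; last exact: cvg_cst.
  apply: (cvg_comp (fun t => (T t)^-1 * U y) (fun u => expR (- u))).
    apply: gt0_cvgMly => //; by rewrite lt_def Uy U0.
  exact: cvgr_expR.
rewrite [X in _ --> X](_ : _ = l x / \sum_y l y).
  under eq_fun do rewrite GibbsE.
  apply: cvgM; first exact: bl.
  apply: cvgV; last by apply: cvg_bigsum => y _; exact: bl.
  have l0 y : 0 <= l y by rewrite /l; case: ifP => // _; exact: ltW.
  rewrite gt_eqF// (bigD1 x0)//= ltr_pwDl ?sumr_ge0//.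
  by rewrite /l minE Ux0 eqxx.
rewrite /pi_min /l; case: ifP => _; last by rewrite mul0r.
by rewrite big_mkcond.
Qed.

(** The term of index y is g h ln h with g the Gibbs weight and h = mu y / g, so
    that [norm_xlnx_le] bounds it by |mu y - g| + (mu y - g)^2 / g. *)
Lemma Ent_Gibbs_le (R : realType) (X : finType) (U pi : X -> R) T
    (mu : X -> R) :
  (forall x, 0 < pi x) -> \sum_x mu x = 1 ->
  `|Ent (Gibbs U pi T) mu| <=
  #|X|%:R * (Num.sqrt (chi2 U pi T^-1 mu) + chi2 U pi T^-1 mu).
Proof.
move=> pi0 mu1; rewrite /Ent; apply: (le_trans (ler_norm_sum _ _ _)).
rewrite mulr_natl -sumr_const; apply: ler_sum => y _.
have [h1 h2] := Gibbs_sub_le U T y pi0 mu1.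
set g := Gibbs U pi T y in h1 h2 *.
have g0 : 0 < g by exact: Gibbs_gt0.
have -> : mu y = g * (mu y / g) by rewrite mulrC divfK// gt_eqF.
rewrite [g * _ / g]mulrAC divff ?gt_eqF// mul1r -mulrA normrM (gtr0_norm g0).
have /(ler_wpM2l (ltW g0)) h3 := norm_xlnx_le (mu y / g).
apply: (le_trans h3); rewrite mulrDr; apply: lerD.
  rewrite -{1}(gtr0_norm g0) -normrM mulrBr mulr1.
  by rewrite [g * _]mulrC divfK ?gt_eqF.
apply: le_trans h2; rewrite le_eqVlt; apply/orP; left; apply/eqP.
by field; rewrite gt_eqF.
Qed.

Theorem theorem3p1 (R : realType) (X : finType) (U : X -> R)
    (Q : X -> X -> R) (pi : X -> R) (eps : R) (P : R -> R -> X -> X -> R)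
    (hX : (1 < #|X|)%N)
    (hU : (forall x, 0 <= U x) /\ (exists x, U x = 0))
    (hQ : is_generator Q)
    (hQerg : ergodic Q)
    (hpi : stationary Q pi)
    (hrev : reversible Q pi)
    (hc : 0 < c_M2 U Q)
    (heps : 0 < eps)
    (hP : transition_semigroup (fun t => M2 U Q (temperature U Q eps t)) P) :
  (forall s : R, 0 <= s ->
     sup (range (fun x : X => TV (P s t x) (pi_min U pi)))
       @[t --> +oo] --> (0 : R)) /\
  (forall x : X,
     Ent (Gibbs U pi (temperature U Q eps t)) (P 0 t x)
       @[t --> +oo] --> (0 : R)).
Proof.
have [U0 [x0 Ux0]] := hU.
have pi0 := stationary_gt0 hQerg hpi hrev.
have sum1 s t x : 0 <= s -> s < t -> \sum_y P s t x y = 1.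
  by move=> s0; exact: (transition_sum1 x (fun u y => sum_M2 _ _ _ _) hP s0).
have chi0 s x (s0 : 0 <= s) :=
  chi2_cvg0 x U0 (ex_intro _ x0 Ux0) hQ hQerg hpi hrev hc heps hP s0.
have sqrt0 s x (s0 : 0 <= s) : Num.sqrt
    (chi2 U pi (temperature U Q eps t)^-1 (P s t x)) @[t --> +oo] --> 0.
  rewrite -[X in _ --> X]sqrtr0.
  by apply: (continuous_cvg _ _ (chi0 s x s0)); exact: sqrt_continuous.
split=> [s s0|x].
- have Gmin := Gibbs_cvg U0 Ux0 pi0 (temperatureV_cvgy (addr_gt0 hc heps)).
  have diff0 x y :
      P s t x y - Gibbs U pi (temperature U Q eps t) y @[t --> +oo] --> 0.
    apply/norm_cvg0P.
    apply: (squeeze_cvgr _ (cvg_cst (0 : R)) (sqrt0 s x s0)).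
    near=> t; rewrite normr_ge0/=.
    have st : s < t by near: t; apply: nbhs_pinfty_gt; exact: num_real.
    by have [] := Gibbs_sub_le U (temperature U Q eps t) y pi0 (sum1 s t x s0 st).
  have lim x y : `|P s t x y - pi_min U pi y| @[t --> +oo] --> 0.
    have h1 := (norm_cvg0P _).2 (diff0 x y).
    have h2 : `|Gibbs U pi (temperature U Q eps t) y - pi_min U pi y|
        @[t --> +oo] --> 0.
      apply/norm_cvg0P; rewrite -[X in _ --> X](subrr (pi_min U pi y)).
      by apply: cvgB; [exact: Gmin|exact: cvg_cst].
    have h : `|P s t x y - Gibbs U pi (temperature U Q eps t) y| +
        `|Gibbs U pi (temperature U Q eps t) y - pi_min U pi y|
        @[t --> +oo] --> 0.
      by rewrite -[X in _ --> X](addr0 0); apply: cvgD; [exact: h1|exact: h2].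
    apply: (squeeze_cvgr _ (cvg_cst (0 : R)) h).
    by near=> t; rewrite normr_ge0/=; exact: ler_distD.
  have TV0 x : TV (P s t x) (pi_min U pi) @[t --> +oo] --> 0.
    rewrite -[X in _ --> X](mulr0 (2^-1 : R)) /TV.
    apply: cvgM; first exact: cvg_cst.
    rewrite [X in _ --> X](_ : _ = \sum_(y : X) 0); last by rewrite big1.
    by apply: cvg_bigsum => y _; exact: lim.
  have TVs : \sum_x TV (P s t x) (pi_min U pi) @[t --> +oo] --> 0.
    rewrite [X in _ --> X](_ : _ = \sum_(x : X) 0); last by rewrite big1.
    by apply: cvg_bigsum => x _; exact: TV0.
  apply: (squeeze_cvgr _ (cvg_cst (0 : R)) TVs).
  near=> t.
  have TV_ge0 x : 0 <= TV (P s t x) (pi_min U pi).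
    by rewrite mulr_ge0 ?invr_ge0 ?sumr_ge0.
  pose rg := range (fun x : X => TV (P s t x) (pi_min U pi)).
  pose S := \sum_x TV (P s t x) (pi_min U pi).
  have ubS : ubound rg S.
    by move=> _ [x _ <-]; rewrite /S (bigD1 x)//= lerDl sumr_ge0.
  have rg0 : rg (TV (P s t x0) (pi_min U pi)) by exists x0.
  apply/andP; split; last by apply: ge_sup => //; exists (TV (P s t x0) (pi_min U pi)).
  apply: (le_trans (TV_ge0 x0)); apply: ub_le_sup rg0.
  by exists S.
- apply/norm_cvg0P.
  have lim : #|X|%:R *
      (Num.sqrt (chi2 U pi (temperature U Q eps t)^-1 (P 0 t x)) +
       chi2 U pi (temperature U Q eps t)^-1 (P 0 t x)) @[t --> +oo] --> 0.
    rewrite -[X in _ --> X](mulr0 (#|X|%:R : R)).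
    apply: cvgM; first exact: cvg_cst.
    by rewrite -[X in _ --> X](addr0 0); apply: cvgD; [exact: sqrt0|exact: chi0].
  apply: (squeeze_cvgr _ (cvg_cst (0 : R)) lim).
  near=> t; rewrite normr_ge0/=; apply: Ent_Gibbs_le => //.
  by apply: sum1 => //; near: t; exact: nbhs_pinfty_gt.
Unshelve. all: by end_near. Qed.
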